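(* For every integer $d\ge 3$ there exist constants $c_d,C_d>0$, depending only on $d$, such that for every integer $r\ge 1$ and every metric space $X$ with at least two points, $$\frac{c_d}{(d-1)^r}\le\lambda(T_{d,r},X)\le\frac{C_d}{(d-1)^r}.$$
   Context: $T_{d,r}$ denotes the $r$-ball in the $d$-regular tree $T_d$, i.e. the (finite) subtree induced on all vertices at graph distance at most $r$ from a fixed center vertex $o$; it is equipped with the uniform weight function. For a finite, simple, connected graph $G=(V,E)$ with at least two vertices, let $\vec{E}=\{(x,y)\in V\times V : \{x,y\}\in E\}$. The uniform weight function on $G$ is $m:V\times V\to[0,\infty)$ with $m(x,y)=1$ if $(x,y)\in\vec{E}$ and $m(x,y)=0$ otherwise. Write $m(x)=\sum_{y\in V}m(x,y)$ and $m(\emptyset)=\sum_{x\in V}m(x)$. For a metric space $(X,d_X)$ with at least two points, the nonlinear spectral gap $\lambda(G,X)$ is the reciprocal of the smallest constant $C>0$ such that for every map $f:V\to X$ $$\frac{1}{m(\emptyset)}\sum_{x,y\in V}m(x)m(y)\,d_X(f(x),f(y))^2\le C\sum_{x,y\in V}m(x,y)\,d_X(f(x),f(y))^2 .$$ *)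

(* Defs.v *)
From HB Require Import structures.
From mathcomp Require Import all_boot all_order all_algebra.
From mathcomp Require Import finmap.
From mathcomp Require Import boolp classical_sets functions cardinality.
From mathcomp Require Import reals topology.

Set Implicit Arguments.
Unset Strict Implicit.
Unset Printing Implicit Defensive.

Import Order.TTheory GRing.Theory Num.Theory.
Local Open Scope classical_set_scope.
Local Open Scope ring_scope.

Section Graphs.
Variable V : choiceType.
Implicit Type e : rel V.

Definition gball e (o : V) (r : nat) : set V :=
  [set x | exists p, [/\ path e o p, last o p = x & (size p <= r)%N]].

Definition induced e (A : {fset V}) : rel A := fun x y => e (val x) (val y).

Definition regular_graph (d : nat) e : Prop :=
  forall u, exists s : seq V,
    [/\ uniq s, size s = d & forall v, e u v = (v \in s)].

Definition connected_graph e : Prop :=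
  forall x y, exists2 p, path e x p & last x p = y.

Definition acyclic_graph e : Prop :=
  forall c : seq V, uniq c -> cycle e c -> (size c <= 2)%N.

Definition is_tree e : Prop :=
  [/\ symmetric e, irreflexive e, connected_graph e & acyclic_graph e].

End Graphs.

(* The vertices of T_d are the words over d letters without two equal          *)
(* consecutive letters; two words are adjacent when one is obtained from the   *)
(* other by prepending a letter (this is the Cayley graph of the free product  *)
(* of d copies of Z/2).  See [tree_adj_regular] and [tree_adj_is_tree].        *)
Definition reduced (d : nat) : pred (seq 'I_d) := sorted (fun a b => a != b).

Definition tree_vertex (d : nat) := {w : seq 'I_d | reduced w}.

Definition tree_adj (d : nat) : rel (tree_vertex d) := fun u v =>
  [exists a : 'I_d, (val v == a :: val u) || (val u == a :: val v)].

Definition tree_root (d : nat) : tree_vertex d := Sub [::] isT.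

(* [fset_set] is only meaningful on finite sets: see [finite_tree_ball].       *)
Definition tree_ball (d r : nat) : {fset tree_vertex d} :=
  fset_set (gball (@tree_adj d) (tree_root d) r).

Definition tree_ball_adj (d r : nat) : rel (tree_ball d r) :=
  induced (@tree_adj d) (A := tree_ball d r).

Section SpectralGap.
Variables (R : realType) (V : finType).

Definition unif_weight (e : rel V) (x y : V) : R := (e x y)%:R.

Implicit Type m : V -> V -> R.

Definition wdeg m (x : V) : R := \sum_y m x y.

Definition wtotal m : R := \sum_x wdeg m x.

Definition poincare m (X : metricType R) (C : R) : Prop :=
  forall f : V -> X,
    (wtotal m)^-1 *
      (\sum_x \sum_y wdeg m x * wdeg m y * mdist (f x) (f y) ^+ 2)
    <= C * \sum_x \sum_y m x y * mdist (f x) (f y) ^+ 2.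

(* The infimum is a minimum: see [inf_poincare].  If no constant is admissible *)
(* then inf set0 = 0, hence the gap is 0.                                      *)
Definition poincare_const m (X : metricType R) : R :=
  inf [set C | 0 < C /\ poincare m X C].

Definition spectral_gap (e : rel V) (X : metricType R) : R :=
  (poincare_const (unif_weight e) X)^-1.

End SpectralGap.

Section TreeFacts.
Variable d : nat.
Local Notation T := (tree_vertex d).
Local Notation adj := (@tree_adj d).

Lemma tree_adjP (u v : T) : reflect
  (exists a, val v = a :: val u \/ val u = a :: val v) (adj u v).
Proof.
apply: (iffP existsP) => -[a].
  by case/orP => /eqP E; exists a; [left|right].
by case=> E; exists a; rewrite E eqxx ?orbT.
Qed.

Lemma tree_adj_sym : symmetric adj.
Proof. by move=> u v; apply: eq_existsb => a; rewrite orbC. Qed.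

Lemma tree_adj_irr : irreflexive adj.
Proof.
move=> u; apply/negbTE/negP => /tree_adjP[a H].
have : size (val u) = size (a :: val u) by case: H => {1}->.
by move/n_Sn.
Qed.

Lemma tree_adj_regular : regular_graph d adj.
Proof.
move=> u.
pose g (a : 'I_d) : seq 'I_d :=
  if val u is b :: w then if a == b then w else a :: b :: w else [:: a].
have gred a : reduced (g a).
  rewrite /g; have : reduced (val u) := valP u.
  case: (val u) => [|b w] //= uP; case: eqP => [_|/eqP ab].
    by move: uP; rewrite /reduced /=; case: w => //= c w /andP[].
  by rewrite /reduced /= ab.
pose h a : T := Sub (g a) (gred a).
have gdiff a b : g a = g b -> a = b.
  rewrite /g; case: (val u) => [[]|c w] //.
  case: eqP => [->|_]; case: eqP => [->|_] //.
  - by move/(congr1 size)/eqP; rewrite /= ltn_eqF.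
  - by move/(congr1 size)/eqP; rewrite /= gtn_eqF.
  - by case.
have hinj : injective h by move=> a b /(congr1 val); rewrite !SubK; apply: gdiff.
exists [seq h a | a <- enum 'I_d]; split.
- by rewrite map_inj_uniq // enum_uniq.
- by rewrite size_map size_enum_ord.
move=> v; apply/tree_adjP/mapP => [[a H]|[a _ ->]]; last first.
  exists a; rewrite SubK /g; case: (val u) => [|b w]; first by left.
  by case: eqP => [->|_]; [right|left].
exists a; first by rewrite mem_enum.
apply: val_inj; rewrite SubK /g; case: H => [vE|->]; last by rewrite eqxx.
have : reduced (val v) := valP v; rewrite vE.
case: (val u) => [|b w] //; rewrite /reduced /= => /andP[ab _].
by rewrite (negPf ab).
Qed.

Lemma tree_root_path (u : T) : exists2 p, path adj u p & last u p = tree_root d.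
Proof.
case: u; elim=> [|a w IH] wP.
  by exists [::] => //; apply: val_inj.
have wP' : reduced w.
  by move: wP; rewrite /reduced /=; case: w {IH} => //= c w /andP[].
have [p pP pl] := IH wP'.
exists (exist _ w wP' :: p) => //=; rewrite pP andbT.
by apply/tree_adjP; exists a; right.
Qed.

Lemma tree_adj_connected : connected_graph adj.
Proof.
move=> x y; have [p pP pl] := tree_root_path x.
have [q qP ql] := tree_root_path y.
exists (p ++ rev (belast y q)).
  rewrite cat_path pP pl -ql rev_path.
  by rewrite (eq_path (e' := adj)) // => u v; rewrite /= tree_adj_sym.
rewrite last_cat pl -ql.
case: q {qP ql} => [|z q] //=.
by rewrite rev_cons last_rcons.
Qed.

Lemma tree_adj_size (u v : T) : adj u v ->
  (size (val v) <= size (val u))%N -> val v = behead (val u).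
Proof.
move=> /tree_adjP[a [->|->]] //=.
by rewrite ltnn.
Qed.

Lemma tree_adj_acyclic : acyclic_graph adj.
Proof.
move=> c cu cc; rewrite leqNgt; apply/negP => c3.
have [x xc xmax] : exists2 x, x \in c &
    forall y, y \in c -> (size (val y) <= size (val x))%N.
  have : c != [::] by case: c c3 {cu cc}.
  elim: (c) => // z s IH _.
  have [->|/IH[x xs xm]] := eqVneq s [::].
    by exists z; rewrite ?mem_head // => y; rewrite inE => /eqP ->.
  have [zx|xz] := leqP (size (val z)) (size (val x)).
    by exists x; rewrite ?inE ?xs ?orbT // => y; rewrite inE => /orP[/eqP->|/xm].
  exists z; rewrite ?mem_head // => y; rewrite inE => /orP[/eqP->//|/xm yx].
  exact: leq_trans yx (ltnW xz).
have [i s sE] := rot_to xc.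
have su : uniq (x :: s) by rewrite -sE rot_uniq.
have sc : cycle adj (x :: s) by rewrite -sE rot_cycle.
have s3 : (2 < size (x :: s))%N by rewrite -sE size_rot.
have sm y : y \in x :: s -> (size (val y) <= size (val x))%N.
  by rewrite -sE mem_rot; apply: xmax.
case: s su sc s3 sm {sE} => [|y s] //.
case: (lastP s) => [|{}s z] // su sc _ sm.
move: sc; rewrite /= rcons_path last_rcons => /andP[xy /andP[_ zx]].
have yE := tree_adj_size xy (sm y _).
rewrite tree_adj_sym in zx.
have zE := tree_adj_size zx (sm z _).
have yz : y = z.
  apply: val_inj; rewrite yE ?zE // !inE ?mem_rcons ?inE eqxx ?orbT //.
by move: su; rewrite /= yz mem_rcons mem_head /= andbF.
Qed.

Lemma tree_adj_is_tree : is_tree adj.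
Proof.
split; [exact: tree_adj_sym|exact: tree_adj_irr|exact: tree_adj_connected|].
exact: tree_adj_acyclic.
Qed.

Lemma finite_tree_ball r : finite_set (gball adj (tree_root d) r).
Proof.
elim: r => [|r IH].
  apply: (@sub_finite_set _ _ [set tree_root d]); last exact: finite_set1.
  by move=> x [p [_ <-]]; rewrite leqn0 size_eq0 => /eqP ->.
apply: (@sub_finite_set _ _ (gball adj (tree_root d) r `|`
  \bigcup_(u in gball adj (tree_root d) r) [set v | adj u v])).
  move=> x [p]; case: (lastP p) => [|{}p y] [].
    by move=> _ <- _; left; exists [::].
  rewrite rcons_path last_rcons size_rcons => /andP[pP py] <- ps.
  by right; exists (last (tree_root d) p) => //; exists p.
rewrite finite_setU; split => //; apply: bigcup_finite => // u _.
have [s [_ _ sE]] := tree_adj_regular u.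
apply: (@sub_finite_set _ _ [set` s]); last exact: finite_seq.
by move=> v /=; rewrite sE.
Qed.

Lemma mem_tree_ball r (x : T) :
  x \in tree_ball d r <-> gball adj (tree_root d) r x.
Proof.
rewrite /tree_ball in_fset_set; last exact: finite_tree_ball.
by rewrite in_setE.
Qed.

End TreeFacts.

Section SpectralGapFacts.
Variables (R : realType) (V : finType) (e : rel V) (X : metricType R).
Local Notation m := (@unif_weight R V e).

Lemma inf_poincare (x y : V) (a b : X) :
  symmetric e -> irreflexive e -> e x y -> a != b ->
  [set C | 0 < C /\ poincare m X C] !=set0 ->
  0 < poincare_const m X /\ poincare m X (poincare_const m X).
Proof.
move=> es ei exy ab; rewrite /poincare_const; set S := [set C | _] => S0.
have m0 u v : 0 <= m u v by rewrite ler0n.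
have w0 u : 0 <= wdeg m u by apply: sumr_ge0.
have wp u v : e u v -> 0 < wdeg m u.
  move=> uv; rewrite /wdeg (bigD1 v) //= {1}/unif_weight uv.
  by rewrite ltr_pwDl // sumr_ge0.
have Sge0 : lbound S 0 by move=> C [/ltW].
have infge0 : 0 <= inf S by apply: lb_le_inf.
have P : poincare m X (inf S).
  move=> f; set L := (X in X <= _); set B := (X in _ * X).
  have B0 : 0 <= B.
    by do 2!(apply: sumr_ge0 => ? _); rewrite mulr_ge0 // exprn_ge0 // mdist_ge0.
  move: B0; rewrite le_eqVlt => /orP[/eqP B0|B0].
    by case: S0 => C [_ /(_ f)]; rewrite -/L -/B -B0 !mulr0.
  rewrite -ler_pdivrMr //; apply: lb_le_inf => // C [_ /(_ f)].
  by rewrite -/L -/B ler_pdivrMr.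
split => //; rewrite lt_def infge0 andbT; apply/negP => /eqP inf0.
have := P (fun z => if z == x then a else b).
rewrite inf0 mul0r leNgt => /negP; apply.
have xy : x != y by apply: contraTneq exy => ->; rewrite ei.
rewrite mulr_gt0 //.
  rewrite invr_gt0 /wtotal (bigD1 x) //= ltr_pwDl ?(wp x y) //.
  exact: sumr_ge0.
have t0 u v : 0 <= wdeg m u * wdeg m v *
    mdist (if u == x then a else b) (if v == x then a else b) ^+ 2.
  by rewrite !mulr_ge0 // mdist_ge0.
rewrite (bigD1 x) //= ltr_pwDl //; last first.
  by apply: sumr_ge0 => u _; apply: sumr_ge0 => v _; apply: t0.
rewrite (bigD1 y) //= ltr_pwDl //; last first.
  by apply: sumr_ge0 => u _; apply: t0.
rewrite eqxx eq_sym (negPf xy) !mulr_gt0 ?(wp x y) ?(wp y x) ?mdist_gt0 //.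
by rewrite es.
Qed.

End SpectralGapFacts.

(* Main.v *)
Require Import Defs.
From mathcomp Require Import all_boot all_order all_algebra.
From mathcomp Require Import finmap.
From mathcomp Require Import boolp classical_sets functions cardinality.
From mathcomp Require Import reals topology.
From mathcomp Require Import ring lra.

Set Implicit Arguments.
Unset Strict Implicit.
Unset Printing Implicit Defensive.

Import Order.TTheory GRing.Theory Num.Theory.
Local Open Scope ring_scope.

(* Let q = d - 1.  For the lower bound on the gap, compare every f x with f o. *)
(* Along the path from o to x, Cauchy-Schwarz with weights 2^i on the i-th     *)
(* edge gives d(f x, f o)^2 <= sum_i 2^i w_i^2, where w_i is the distance      *)
(* between the images of the ends of the i-th edge.  Summing over the sphere   *)
(* of radius k, an edge at level i is counted at most q^(k-i) times, hence     *)
(* has weight at most q^(k-i) 2^i <= q^k; summing over k <= r loses a factor 2.*)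
(* For the upper bound, test with a two-valued map that separates one branch   *)
(* at o from the rest: a single edge is cut, while both sides have at least    *)
(* q^(r-1) vertices.                                                           *)

(** With q = d - 1, the claim is that the best Poincare constant of the ball has order q^r up to
    factors depending only on d; the gap is its reciprocal. For the upper estimate of the constant,
    [poincare_of_center] reduces pairs of vertices to distances from the centre. Degrees are at most
    d, and the squared distances are dominated by edge energies of total weight at most 2 q^r per
    edge ([sqr_le_path_energy], [sum_path_energy]). Only the triangle inequality in X enters, so the
    bound is uniform in X. For the lower estimate, two distinct points of X give a two-valued test
    map ([poincare_cut]) that cuts the single edge at the foot of a branch ([sum_branch_cut_le]) and
    has mass at least q^(r-1) on either side ([card_branch_ge]). By [inf_poincare] the infimum is
    itself a positive admissible constant, so both estimates apply to it. *)

Section RootedTree.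
Variables (R : realFieldType) (V : finType) (lev : V -> nat) (par : V -> V).
Variable q : nat.
Hypothesis q_ge2 : (2 <= q)%N.
Hypothesis lev_par : forall x, lev (par x) = (lev x).-1.
Hypothesis few_children : forall y, (0 < lev y)%N ->
  (#|[pred x | (0 < lev x)%N && (par x == y)]| <= q)%N.

(** For [k = lev x] this is the sum of 2^i w_i over the path from the root to [x], the edge into a
    level-i vertex being indexed by that vertex. *)
Fixpoint path_energy (w : V -> R) (k : nat) (x : V) : R :=
  if k is j.+1 then 2 ^+ k * w x + path_energy w j (par x) else 0.

Lemma path_energy_ge0 (w : V -> R) k x :
  (forall x, 0 <= w x) -> 0 <= path_energy w k x.
Proof.
move=> w0; elim: k x => //= k IH x.
by rewrite addr_ge0 // mulr_ge0 // exprn_ge0.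
Qed.

(* Cauchy-Schwarz with the weights 2^-i, which sum to 1 - 2^-k over a path.    *)
Lemma sqr_le_path_energy (D w : V -> R) :
  (forall x, 0 <= w x) -> (forall x, 0 <= D x) ->
  (forall x, lev x = 0 -> D x = 0) -> (forall x, D x <= D (par x) + w x) ->
  forall x, D x ^+ 2 <= path_energy (fun x => w x ^+ 2) (lev x) x.
Proof.
move=> w0 D0 Dr Dp x; set phi := path_energy _.
have phi0 k y : 0 <= phi k y by apply: path_energy_ge0 => z; apply: sqr_ge0.
(* The induction needs the exact partial sum 1 - 2^-k of the weights, not just the bound 1. *)
suff {x} H k x : lev x = k -> D x ^+ 2 <= (1 - 2^-1 ^+ k) * phi k x.
  apply: le_trans (H _ _ erefl) _.
  by rewrite ler_piMl // gerBl exprn_ge0 // invr_ge0.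
elim: k x => [|k IH] x lx; first by rewrite Dr // expr0n /= mulr0.
have {}IH : D (par x) ^+ 2 <= (1 - 2^-1 ^+ k) * phi k (par x).
  by apply: IH; rewrite lev_par lx.
have pE : phi k.+1 x = 2 ^+ k.+1 * w x ^+ 2 + phi k (par x) by [].
rewrite pE; move: (phi0 k (par x)) IH; set P := phi k _ => P0 IH.
set A := 2 ^+ k.+1; set t := 2^-1 ^+ k.+1.
have At : A * t = 1 by rewrite /A /t -exprMn divff ?expr1n ?pnatr_eq0.
have tE : 2^-1 ^+ k = 2 * t by rewrite /t exprS mulrA divff ?mul1r ?pnatr_eq0.
rewrite tE in IH.
have t0 : 0 < t by rewrite exprn_gt0 // invr_gt0 ltr0n.
have A0 : 0 < A by rewrite exprn_gt0 // ltr0n.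
have t1 : 2 * t <= 1 by rewrite -tE exprn_ile1 // ?invr_ge0 ?invf_le1 // ler1n.
have DD : D x ^+ 2 <= (D (par x) + w x) ^+ 2.
  by rewrite lerXn2r ?nnegrE ?addr_ge0.
apply: le_trans DD _.
(* AM-GM, since u^2 <= a P and A t = 1 *)
move: (w0 x) (D0 (par x)); set v := w x; set u := D (par x) in IH * => v0 u0.
set a := 1 - 2 * t in IH.
have a0 : 0 <= a by rewrite subr_ge0.
suff : 2 * u * v <= t * P + a * A * v ^+ 2.
  have -> : 1 - t = a + t by rewrite /a; ring.
  have -> : (a + t) * (A * v ^+ 2 + P)
    = a * A * v ^+ 2 + (A * t) * v ^+ 2 + a * P + t * P by ring.
  by rewrite At mul1r; lra.
(* Here a = 1 - 2^-k vanishes exactly when the parent is at level 0; otherwise the inequality may be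
   multiplied by a. *)
have [a_eq0|an0] := eqVneq a 0.
  have -> : u = 0.
    by apply/eqP; rewrite -sqrf_eq0 eq_le sqr_ge0 andbT (le_trans IH) // a_eq0 mul0r.
  by rewrite a_eq0 !(mulr0, mul0r) addr0 mulr_ge0 // ltW.
have ap : 0 < a by rewrite lt_def an0.
have uP : t * u ^+ 2 <= t * (a * P) by rewrite ler_pM2l.
have s0 : 0 <= t * (u - a * A * v) ^+ 2 by rewrite mulr_ge0 ?sqr_ge0 // ltW.
rewrite -(ler_pM2l ap).
have E : t * (u - a * A * v) ^+ 2 =
  t * u ^+ 2 - (A * t) * (2 * a * u * v) + (A * t) * (a ^+ 2 * A * v ^+ 2) by ring.
rewrite E At !mul1r in s0.
have -> : a * (2 * u * v) = 2 * a * u * v by ring.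
have -> : a * (t * P + a * A * v ^+ 2) = t * (a * P) + a ^+ 2 * A * v ^+ 2 by ring.
by lra.
Qed.

(** Induction on the level: the last edges have weight 2^k <= q^k, and the remaining energy depends
    only on the parent, which is shared by at most q vertices. *)
Lemma sum_path_energy_level (w : V -> R) (k : nat) :
  (forall x, 0 <= w x) ->
  \sum_(x | lev x == k) path_energy w k x
    <= q%:R ^+ k * \sum_(x | (0 < lev x <= k)%N) w x.
Proof.
move=> w0; elim: k => [|k IH].
  rewrite (eq_bigr (fun=> 0)) // big1 //.
  by rewrite mulr_ge0 // ?exprn_ge0 ?ler0n // sumr_ge0.
have -> : \sum_(x | (0 < lev x <= k.+1)%N) w x =
    \sum_(x | lev x == k.+1) w x + \sum_(x | (0 < lev x <= k)%N) w x.
  rewrite (bigID (fun x => lev x == k.+1)) /=; congr (_ + _); apply: eq_bigl => x.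
    by case: eqP => [->|]; rewrite ?andbT ?andbF //= leqnn.
  by rewrite -andbA -(andbC (_ != _)) -ltn_neqAle ltnS.
rewrite /= big_split /= mulrDr lerD //.
  rewrite -mulr_sumr ler_wpM2r //; first exact: sumr_ge0.
  by rewrite lerXn2r ?nnegrE ?ler0n // ler_nat.
(* A vertex at level 0 is not covered by [few_children] (the centre of the ball can have q + 1
   children), but the energy left above level 1 is zero. *)
case: k IH => [|k] IH.
  by rewrite big1 // mulr_ge0 // ?exprn_ge0 ?ler0n // sumr_ge0.
rewrite exprS -mulrA; apply: le_trans (ler_wpM2l (ler0n _ _) IH).
rewrite (partition_big par (fun y => lev y == k.+1)); last first.
  by move=> x /eqP xk; rewrite lev_par xk.
rewrite mulr_sumr; apply: ler_sum => y /eqP yk.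
rewrite (eq_bigr (fun=> path_energy w k.+1 y)); last by move=> x /andP[_ /eqP->].
rewrite sumr_const -[leLHS]mulr_natl ler_wpM2r ?path_energy_ge0 // ler_nat.
apply: leq_trans (@few_children y _); last by rewrite yk.
by apply: subset_leq_card; apply/fintype.subsetP => x; rewrite !inE => /andP[/eqP-> ->].
Qed.

Lemma sum_path_energy (w : V -> R) (r : nat) :
  (forall x, 0 <= w x) -> (forall x, (lev x <= r)%N) ->
  \sum_x path_energy w (lev x) x
    <= 2 * q%:R ^+ r * \sum_(x | (0 < lev x)%N) w x.
Proof.
move=> w0 lr; set W := \sum_(x | _) w x.
have W0 : 0 <= W by apply: sumr_ge0.
have -> : \sum_x path_energy w (lev x) x =
    \sum_(k < r.+1) \sum_(x | lev x == k) path_energy w k x.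
  rewrite (partition_big (fun x => Ordinal (lr x : (lev x < r.+1)%N)) predT) //=.
  by apply: eq_bigr => k _; apply: eq_big => [x //|x /eqP <-].
apply: (@le_trans _ _ (\sum_(k < r.+1) q%:R ^+ k * W)).
  apply: ler_sum => k _; apply: le_trans (sum_path_energy_level _ w0) _.
  rewrite ler_wpM2l ?exprn_ge0 ?ler0n //.
  rewrite /W [leRHS](bigID (fun x => (lev x <= k)%N)) /= lerDl.
  exact: sumr_ge0.
rewrite -mulr_suml ler_wpM2r // {W W0 w0 lr}.
have q2 : 2 <= q%:R :> R by rewrite (ler_nat _ 2).
(* Geometric sum: 2 q^r + q^(r+1) <= 2 q^(r+1) because q >= 2. *)
elim: r => [|r IH]; first by rewrite big_ord1 expr0; lra.
have : 0 <= q%:R ^+ r :> R by rewrite exprn_ge0 ?ler0n.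
by rewrite big_ord_recr exprS /=; nra.
Qed.

End RootedTree.

(** * Two general estimates of Poincare constants *)

Section PoincareBounds.
Variables (R : realType) (V : finType) (m : V -> V -> R) (X : metricType R).
Hypothesis m_ge0 : forall x y, 0 <= m x y.

Let wdeg_ge0 x : 0 <= wdeg m x. Proof. exact: sumr_ge0. Qed.

(** From d(a,b)^2 <= 2 d(a,f o)^2 + 2 d(b,f o)^2, summed against the product of degrees: each of the
    two terms contributes 2 [S] [wtotal m], hence the factor 4. *)
Lemma poincare_of_center (o : V) (K : R) : 0 < wtotal m ->
  (forall f : V -> X, \sum_x wdeg m x * mdist (f x) (f o) ^+ 2
     <= K * \sum_x \sum_y m x y * mdist (f x) (f y) ^+ 2) ->
  poincare m X (4 * K).
Proof.
move=> M0 HK f; have {HK} := HK f; set B := \sum_x \sum_y _ => HK.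
rewrite mulrC ler_pdivrMr //.
have sqb (a b : X) :
    mdist a b ^+ 2 <= 2 * mdist a (f o) ^+ 2 + 2 * mdist b (f o) ^+ 2.
  have := metric_triangle a (f o) b; rewrite (metric_sym (f o)).
  have := mdist_ge0 a b; have := mdist_ge0 a (f o); have := mdist_ge0 b (f o).
  move: (mdist a b) (mdist a (f o)) (mdist b (f o)) => w u v v0 u0 w0 wuv.
  have := sqr_ge0 (u - v); have : w ^+ 2 <= (u + v) ^+ 2.
    by rewrite lerXn2r ?nnegrE ?addr_ge0.
  by rewrite !expr2; nra.
set S := \sum_x _ in HK.
apply: (@le_trans _ _ (4 * S * wtotal m)); last by rewrite ler_pM2r // -mulrA ler_pM2l.
apply: (@le_trans _ _ (\sum_x \sum_y (2 * (wdeg m x * mdist (f x) (f o) ^+ 2) * wdeg m y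
     + 2 * wdeg m x * (wdeg m y * mdist (f y) (f o) ^+ 2)))).
  apply: ler_sum => x _; apply: ler_sum => y _.
  apply: le_trans (ler_wpM2l _ (sqb (f x) (f y))) _; first by rewrite mulr_ge0.
  by rewrite mulrDr lerD // le_eqVlt; apply/orP; left; apply/eqP; ring.
under eq_bigr => x _.
  rewrite big_split /= -!mulr_sumr -/S; over.
rewrite big_split /= -!mulr_suml -!mulr_sumr -/S -/(wtotal m).
by rewrite le_eqVlt; apply/orP; left; apply/eqP; ring.
Qed.

(** The test map is [a] on [A] and [b] off it. The left side becomes the harmonic mean of the two
    masses, times the squared distance, and a harmonic mean is at least the minimum. The cut bound
    is 2 because an edge counts in both orientations. *)
Lemma poincare_cut (a b : X) (A : {pred V}) (C Q : R) :
  a != b -> 0 < Q -> 0 <= C -> poincare m X C ->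
  Q <= \sum_(x in A) wdeg m x -> Q <= \sum_(x in predC A) wdeg m x ->
  \sum_x \sum_y m x y * ((x \in A) != (y \in A))%:R <= 2 ->
  Q <= 2 * C.
Proof.
move=> ab Q0 C0 PC; have /= {PC} := PC (fun x => if x \in A then a else b).
set D := mdist a b ^+ 2.
have D0 : 0 < D by rewrite exprn_gt0 // mdist_gt0.
have dE x y : mdist (if x \in A then a else b) (if y \in A then a else b) ^+ 2 =
    ((x \in A) != (y \in A))%:R * D.
  case: (x \in A); case: (y \in A); rewrite /= ?mdistxx ?expr0n ?mul0r ?mul1r //.
  by rewrite metric_sym.
set SA := \sum_(x in A) _; set SB := \sum_(x in _) _ => H QA QB.
set cut := \sum_x _ => cut2; move: H.
have tE : wtotal m = SA + SB by rewrite /wtotal (bigID (mem A)) /=.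
have -> : \sum_x \sum_y wdeg m x * wdeg m y *
    mdist (if x \in A then a else b) (if y \in A then a else b) ^+ 2 =
    2 * SA * SB * D.
  rewrite (bigID (mem A)) /=.
  rewrite (eq_bigr (fun x => wdeg m x * (SB * D))) => [|x xA]; last first.
    rewrite (bigID (mem A)) /= big1 => [|y yA]; last first.
      by rewrite dE xA yA mul0r mulr0.
    rewrite add0r (eq_bigr (fun y => wdeg m x * D * wdeg m y)) => [|y /negPf yA].
      by rewrite -mulr_sumr -/SB mulrAC mulrA.
    by rewrite dE xA yA mul1r mulrAC.
  rewrite [X in _ + X](eq_bigr (fun x => wdeg m x * (SA * D))) => [|x /negPf xA]; last first.
    rewrite (bigID (mem A)) /= [X in _ + X]big1 => [|y /negPf yA]; last first.
      by rewrite dE xA yA mul0r mulr0.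
    rewrite addr0 (eq_bigr (fun y => wdeg m x * D * wdeg m y)) => [|y yA].
      by rewrite -mulr_sumr -/SA mulrAC mulrA.
    by rewrite dE xA yA mul1r mulrAC.
  by rewrite -!mulr_suml -/SA -/SB; ring.
have -> : \sum_x \sum_y m x y *
    mdist (if x \in A then a else b) (if y \in A then a else b) ^+ 2 = cut * D.
  rewrite mulr_suml; apply: eq_bigr => x _; rewrite mulr_suml; apply: eq_bigr => y _.
  by rewrite dE mulrA.
have t0 : 0 < SA + SB by lra.
rewrite tE mulrC ler_pdivrMr // => H.
have {}H : 2 * SA * SB <= C * cut * (SA + SB).
  by rewrite -(ler_pM2r D0) (le_trans H) // le_eqVlt; apply/orP; left; apply/eqP; ring.
have H2 : C * cut * (SA + SB) <= C * 2 * (SA + SB).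
  by rewrite ler_pM2r // ler_wpM2l.
have H3 : Q * (SA + SB) <= 2 * SA * SB by nra.
rewrite -(ler_pM2r t0) (le_trans H3) // (le_trans H) // (le_trans H2) //.
by rewrite (mulrC C).
Qed.

End PoincareBounds.

Lemma sum_nat_of_bool (I : finType) (P : pred I) : (\sum_x P x = #|P|)%N.
Proof.
rewrite -sum1_card [RHS]big_mkcond; apply: eq_bigr => x _.
by rewrite -[x \in P]/(P x); case: (P x).
Qed.

(** * The combinatorics of the ball, seen as a set of reduced words *)

Section TreeBall.
Variable d : nat.
Local Notation T := (tree_vertex d).
Local Notation adj := (@tree_adj d).

Lemma gball_tree_root (r : nat) (u : T) :
  gball adj (tree_root d) r u <-> (size (val u) <= r)%N.
Proof.
split=> [[p [pP <- pr]]|ur].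
  suff H (x : T) : path adj x p -> (size (val (last x p)) <= size (val x) + size p)%N.
    by apply: leq_trans (H _ pP) _.
  elim: p x {pP pr} => [|y p IH] x /=; first by rewrite addn0.
  move=> /andP[/tree_adjP[a xy] /IH] /leq_trans; apply.
  rewrite addnS -addSn leq_add2r.
  by case: xy => -> //=; rewrite leqW.
suff [p [pP pu pE]] : exists p, [/\ path adj (tree_root d) p,
    last (tree_root d) p = u & size p = size (val u)].
  by exists p; rewrite pE.
case: u {ur} => /=; elim=> [|a w IH] wP.
  by exists [::]; split => //; apply: val_inj.
have wP' : reduced w by apply: path_sorted wP.
have [p [pP pl ps]] := IH wP'.
exists (rcons p (exist _ (a :: w) wP)).
rewrite rcons_path last_rcons size_rcons ps pP pl; split=> //=.
by apply/tree_adjP; exists a; left.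
Qed.

Lemma mem_tree_ball_size (r : nat) (u : T) :
  (u \in tree_ball d r) = (size (val u) <= r)%N.
Proof.
by apply/idP/idP => [/mem_tree_ball/gball_tree_root|/gball_tree_root/mem_tree_ball].
Qed.

Lemma reduced_behead (w : seq 'I_d) : reduced w -> reduced (behead w).
Proof. by case: w => //= a w; apply: path_sorted. Qed.

Definition tree_parent (u : T) : T :=
  exist _ (behead (val u)) (reduced_behead (valP u)).

(** Codes the reduced words ending in [c]: [lift] skips the current head, so each further letter is
    a free choice among d - 1. *)
Fixpoint extend_word (c : 'I_d) (t : seq 'I_d.-1) : seq 'I_d :=
  if t is a :: s then
    let w := extend_word c s in lift (head c w) a :: w
  else [:: c].

Lemma size_extend_word c t : size (extend_word c t) = (size t).+1.
Proof. by elim: t => //= a t ->. Qed.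

Lemma reduced_extend_word c t : reduced (extend_word c t).
Proof.
elim: t => //= a t; have := size_extend_word c t.
case: (extend_word c t) => //= b w _; rewrite /reduced /= => ->.
by rewrite andbT eq_sym neq_lift.
Qed.

Lemma last_extend_word c b t : last b (extend_word c t) = c.
Proof. by elim: t b => //= a t IH b. Qed.

Lemma extend_word_inj c : injective (extend_word c).
Proof.
elim=> [|a t IH] [|b s] //=.
- by case=> _ /(congr1 size); rewrite size_extend_word.
- by case=> _ /(congr1 size); rewrite size_extend_word.
- move=> E; have ts := IH _ (congr1 behead E).
  by have := congr1 (head c) E; rewrite ts /= => /lift_inj ->.
Qed.

Variable r : nat.
Local Notation B := (tree_ball d r).
Local Notation e := (@tree_ball_adj d r).

Definition ball_level (x : B) : nat := size (val (val x)).

Lemma ball_level_le x : (ball_level x <= r)%N.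
Proof. by rewrite /ball_level -mem_tree_ball_size; apply: valP. Qed.

Fact ball_parent_subproof (x : B) : tree_parent (val x) \in B.
Proof.
rewrite mem_tree_ball_size size_behead.
exact: leq_trans (leq_pred _) (ball_level_le x).
Qed.

Definition ball_parent (x : B) : B := FSetSub (ball_parent_subproof x).

Lemma ball_level_parent x : ball_level (ball_parent x) = (ball_level x).-1.
Proof. by rewrite /ball_level size_behead. Qed.

Fact ball_center_subproof : tree_root d \in B.
Proof. by rewrite mem_tree_ball_size. Qed.

Definition ball_center : B := FSetSub ball_center_subproof.

Lemma ball_level_eq0 x : ball_level x = 0 -> x = ball_center.
Proof. by move/size0nil => x0; do 2!apply: val_inj. Qed.

Lemma tree_ball_adj_sym : symmetric e.
Proof. by move=> x y; apply: tree_adj_sym. Qed.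

Lemma tree_ball_adj_irr : irreflexive e.
Proof. by move=> x; apply: tree_adj_irr. Qed.

Lemma tree_ball_adj_parent x : (0 < ball_level x)%N -> e x (ball_parent x).
Proof.
rewrite /ball_level /tree_ball_adj /induced => x0; apply/tree_adjP.
by move: x0; case E: (val (val x)) => [|a w] // _; exists a; right; rewrite /= E.
Qed.

(** A child of the word b :: w is determined by its head, which must differ from b. *)
Lemma ball_few_children y : (0 < ball_level y)%N ->
  (#|[pred x | (0 < ball_level x)%N && (ball_parent x == y)]| <= d.-1)%N.
Proof.
rewrite /ball_level; case E: (val (val y)) => [|b w] // _.
have -> : d.-1 = #|predC1 b|.
  by rewrite -[in LHS](card_ord d) -(cardC1 b).
pose h (x : B) := head b (val (val x)).
set P := [pred x | _].
have hP x : x \in P -> val (val x) = h x :: b :: w.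
  rewrite inE /ball_level /h => /andP[+ /eqP xy].
  have {xy} : behead (val (val x)) = b :: w by rewrite -E -xy.
  by case: (val (val x)) => //= c s ->.
rewrite -(card_in_imset (f := h) (D := P)); last first.
  by move=> x z xP zP hxz; do 2!apply: val_inj; rewrite !hP // hxz.
apply: subset_leq_card; apply/fintype.subsetP => a /imsetP[x xP ->].
have := valP (val x); rewrite /= hP // /reduced /= => /andP[+ _].
by rewrite !inE.
Qed.

Lemma wdeg_tree_ball_le (R : realType) x : wdeg (@unif_weight R _ e) x <= d%:R.
Proof.
have [s [su ss sE]] := tree_adj_regular (val x).
rewrite /wdeg /unif_weight -natr_sum ler_nat sum_nat_of_bool.
rewrite -(size_image (val : B -> T)).
apply: (@leq_trans (size s)); last by rewrite ss.
apply: uniq_leq_size; first by rewrite map_inj_uniq ?enum_uniq //; apply: val_inj.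
by move=> _ /fintype.imageP[y xy ->]; rewrite -sE.
Qed.

Lemma wdeg_tree_ball_ge1 (R : realType) x : (0 < d)%N -> (0 < r)%N ->
  1 <= wdeg (@unif_weight R _ e) x.
Proof.
move=> d0 r0; have [y xy] : exists y, e x y.
  have [x0|x0] := posnP (ball_level x); last first.
    by exists (ball_parent x); apply: tree_ball_adj_parent.
  have yP : (exist _ [:: Ordinal d0] isT : T) \in B by rewrite mem_tree_ball_size.
  exists (FSetSub yP); rewrite (ball_level_eq0 x0); apply/tree_adjP.
  by exists (Ordinal d0); left.
rewrite /wdeg (bigD1 y) //= {1}/unif_weight xy lerDl.
by apply: sumr_ge0 => z _; rewrite ler0n.
Qed.

(** Letters are prepended, so the last letter names the first edge out of the centre. The level
    condition excludes the centre, where [last c] would return its default [c]. *)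
Definition branch (c : 'I_d) : pred B :=
  fun x => (0 < ball_level x)%N && (last c (val (val x)) == c).

Lemma branch_disjoint (a b : 'I_d) x : a != b -> branch b x -> ~~ branch a x.
Proof.
rewrite /branch /ball_level => ab; case: (val (val x)) => //= c w /eqP ->.
by rewrite eq_sym.
Qed.

(** Counting only the words of length r already suffices. *)
Lemma card_branch_ge (c : 'I_d) : (0 < r)%N -> (d.-1 ^ r.-1 <= #|branch c|)%N.
Proof.
move=> r0; rewrite -[X in (X ^ _)%N](card_ord d.-1) -card_tuple.
have gP (t : r.-1.-tuple 'I_d.-1) :
    (exist _ (extend_word c t) (reduced_extend_word c t) : T) \in B.
  by rewrite mem_tree_ball_size /= size_extend_word size_tuple prednK.
pose g t : B := FSetSub (gP t).
have g_inj : injective g.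
  by move=> t s /(congr1 (val \o val)) /= /extend_word_inj/val_inj.
rewrite -(card_codom g_inj); apply: subset_leq_card.
apply/fintype.subsetP => _ /codomP[t ->].
by rewrite unfold_in /branch /ball_level /= size_extend_word last_extend_word eqxx.
Qed.

(** Adding or removing a head letter changes the last letter only when one of the words is empty. *)
Lemma branch_cut (c : 'I_d) (x y : B) : e x y -> branch c x -> ~~ branch c y ->
  y = ball_center /\ val (val x) = [:: c].
Proof.
rewrite /branch /ball_level => /tree_adjP[a [] E].
  rewrite E /=; case: (val (val x)) => //= b w.
  by move=> ->.
rewrite E /=; case Ey: (val (val y)) => [|b w] /=.
  move=> /eqP -> _; split=> //; exact/ball_level_eq0/(congr1 size Ey).
by move=> ->.
Qed.

Lemma sum_branch_cut_le (R : realType) (c : 'I_d) :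
  \sum_(x : B) \sum_(y : B)
    unif_weight R e x y * ((x \in branch c) != (y \in branch c))%:R <= 2.
Proof.
pose z (x : B) := val (val x) == [:: c].
have inb u : (u \in branch c) = branch c u by [].
have z1 : \sum_(x : B) (z x)%:R <= 1 :> R.
  rewrite -natr_sum (ler_nat _ _ 1) sum_nat_of_bool.
  apply/card_le1P => x xz y; rewrite !inE; apply/idP/eqP => [yz|->//].
  by do 2!apply: val_inj; rewrite (eqP xz) (eqP yz).
have o1 : \sum_(x : B) (x == ball_center)%:R = 1 :> R.
  by rewrite (bigD1 ball_center) //= ?eqxx big1 ?addr0 // => x /negPf ->.
have -> : 2 = 1 + 1 :> R by ring.
apply: (@le_trans _ _ (\sum_(x : B) \sum_(y : B)
   ((z x)%:R * (y == ball_center)%:R + (x == ball_center)%:R * (z y)%:R))).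
  apply: ler_sum => x _; apply: ler_sum => y _; rewrite /unif_weight.
  have [exy|_] := boolP (e x y); last first.
    by rewrite mul0r addr_ge0 // mulr_ge0 ?ler0n.
  rewrite mul1r; have [_|bxy] := eqVneq (x \in branch c) (y \in branch c).
    by rewrite addr_ge0 // mulr_ge0 ?ler0n.
  move: bxy; rewrite !inb; case bx: (branch c x).
    case bby: (branch c y) => // _.
    have [-> /eqP zx] := branch_cut exy bx (negbT bby).
    by rewrite /z zx eqxx mulr1 lerDl mulr_ge0 ?ler0n.
  case bby: (branch c y) => // _; rewrite tree_ball_adj_sym in exy.
  have [-> /eqP zy] := branch_cut exy bby (negbT bx).
  by rewrite /z zy eqxx mulr1 lerDr mulr_ge0 ?ler0n.
under eq_bigr do rewrite big_split /= -!mulr_sumr o1 mulr1.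
by rewrite big_split /= -mulr_suml o1 mul1r lerD.
Qed.

End TreeBall.

(** * Upper and lower estimates for the ball, and the conclusion *)

Lemma poincare_tree_ball (R : realType) (X : metricType R) (d r : nat) :
  (3 <= d)%N -> (1 <= r)%N ->
  poincare (unif_weight R (@tree_ball_adj d r)) X (8 * d%:R * d.-1%:R ^+ r).
Proof.
move=> d3 r1; set m := unif_weight _ _.
have m0 x y : 0 <= m x y by rewrite ler0n.
have w1 x : 1 <= wdeg m x.
  by apply: wdeg_tree_ball_ge1 => //; apply: leq_trans d3.
have M0 : 0 < wtotal m.
  rewrite /wtotal (bigD1 (ball_center d r)) //= ltr_pwDl ?sumr_ge0 //.
    exact: lt_le_trans ltr01 (w1 _).
  by move=> x _; apply: le_trans ler01 (w1 x).
(* The factors: 4 from [poincare_of_center], d from the degrees, 2 q^r from [sum_path_energy]. *)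
have -> : 8 * d%:R * d.-1%:R ^+ r = 4 * (d%:R * (2 * d.-1%:R ^+ r)) :> R by ring.
apply: (poincare_of_center m0 (o := ball_center d r)) => // f.
pose w x := mdist (f x) (f (ball_parent x)).
have D_le x : mdist (f x) (f (ball_center d r)) ^+ 2 <=
    path_energy (@ball_parent d r) (fun x => w x ^+ 2) (ball_level x) x.
  apply: (sqr_le_path_energy (@ball_level_parent d r)
    (D := fun x => mdist (f x) (f (ball_center d r)))) => [y|y|y y0|y].
  - exact: mdist_ge0.
  - exact: mdist_ge0.
  - by rewrite (ball_level_eq0 y0) mdistxx.
  - by rewrite addrC metric_triangle.
apply: (@le_trans _ _ (d%:R * \sum_x path_energy (@ball_parent d r)
    (fun x => w x ^+ 2) (ball_level x) x)).
  rewrite mulr_sumr; apply: ler_sum => x _.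
  by rewrite ler_pM ?wdeg_tree_ball_le ?exprn_ge0 ?mdist_ge0 // (le_trans ler01).
rewrite -mulrA ler_wpM2l ?ler0n //.
apply: le_trans (sum_path_energy (q := d.-1) _ _ _ _ _) _.
- by case: d d3 {m m0 w1 M0 f w D_le}.
- exact: ball_level_parent.
- exact: ball_few_children.
- by move=> x; apply: sqr_ge0.
- exact: ball_level_le.
rewrite ler_wpM2l ?mulr_ge0 ?exprn_ge0 ?ler0n // big_mkcond ler_sum // => x _.
have s0 (P : pred _) : 0 <= \sum_(y | P y) m x y * mdist (f x) (f y) ^+ 2.
  by apply: sumr_ge0 => y _; rewrite mulr_ge0 // exprn_ge0 // mdist_ge0.
(* Among the neighbours of [x] only the parent is kept. *)
case: ifP => // x0; rewrite (bigD1 (ball_parent x)) //=.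
by rewrite {1}/m /unif_weight tree_ball_adj_parent // mul1r lerDl s0.
Qed.

Lemma poincare_tree_ball_ge (R : realType) (X : metricType R) (d r : nat)
    (a b : X) (C : R) :
  (3 <= d)%N -> (1 <= r)%N -> a != b -> 0 < C ->
  poincare (unif_weight R (@tree_ball_adj d r)) X C ->
  d.-1%:R ^+ r.-1 <= 2 * C.
Proof.
move=> d3 r1 ab C0 PC.
have d0 : (0 < d)%N by apply: leq_trans d3.
have d2 : (1 < d)%N by apply: leq_trans d3.
(* Branch [i] is one side of the cut; the disjoint branch [j] makes the other side large. *)
pose i : 'I_d := Ordinal d0; pose j : 'I_d := Ordinal d2.
set m := unif_weight _ _ in PC.
have bQ c (A : {pred tree_ball d r}) : {subset branch c <= A} ->
    d.-1%:R ^+ r.-1 <= \sum_(x in A) wdeg m x.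
  move=> cA; apply: (@le_trans _ _ (\sum_(x in A) 1)); last first.
    by apply: ler_sum => x _; apply: wdeg_tree_ball_ge1.
  rewrite sumr_const -natrX ler_nat (leq_trans (card_branch_ge c r1)) //.
  by apply: subset_leq_card; apply/fintype.subsetP.
apply: (poincare_cut (A := branch i) ab _ (ltW C0) PC).
- by rewrite exprn_gt0 // ltr0n; case: d d3 {d0 d2 i j m PC bQ} => [|[]].
- exact: (bQ i).
- by apply: (bQ j) => x xj; rewrite !inE; apply: branch_disjoint xj.
- exact: sum_branch_cut_le.
Qed.

Theorem corollary3p4 (R : realType) (d : nat) (d_ge3 : (3 <= d)%N) :
  exists c C : R, [/\ 0 < c, 0 < C &
    forall (r : nat) (r_ge1 : (1 <= r)%N)
           (X : metricType R) (X_ge2 : exists a b : X, a != b),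
      c / (d%:R - 1) ^+ r <= spectral_gap (@tree_ball_adj d r) X /\
      spectral_gap (@tree_ball_adj d r) X <= C / (d%:R - 1) ^+ r].
Proof.
have d0 : (0 < d)%N by apply: leq_trans d_ge3.
have q0 : (0 < d.-1)%N by case: d d_ge3 {d0} => [|[]].
have qE : d%:R - 1 = d.-1%:R :> R by rewrite -[in LHS](prednK d0) -natr1 addrK.
have dR0 : 0 < d%:R :> R by rewrite ltr0n.
have qR0 : 0 < d.-1%:R :> R by rewrite ltr0n.
(* Inverting q^(r-1) / 2 <= P <= 8 d q^r for the best constant P; the extra q in the second witness
   turns q^(r-1) into q^r. *)
exists (8 * d%:R)^-1, (2 * d.-1%:R); split; rewrite ?invr_gt0 ?mulr_gt0 ?ltr0n //.
move=> r r1 X [a [b ab]]; rewrite qE /spectral_gap.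
have PU := @poincare_tree_ball R X d r d_ge3 r1.
have U0 : 0 < 8 * d%:R * d.-1%:R ^+ r :> R by rewrite !mulr_gt0 ?exprn_gt0.
set S := [set C | 0 < C /\ poincare (unif_weight R (@tree_ball_adj d r)) X C]%classic.
have S0 : (S !=set0)%classic by exists (8 * d%:R * d.-1%:R ^+ r).
have [x xc] : exists x : tree_ball d r, tree_ball_adj x (ball_center d r).
  have xP : (exist _ [:: Ordinal d0] isT : tree_vertex d) \in tree_ball d r.
    by rewrite mem_tree_ball_size.
  exists (FSetSub xP); apply/tree_adjP; exists (Ordinal d0); by right.
have [I0 PI] := inf_poincare (@tree_ball_adj_sym d r) (@tree_ball_adj_irr d r) xc ab S0.
have lo := poincare_tree_ball_ge d_ge3 r1 ab I0 PI.
have hi : poincare_const (unif_weight R (@tree_ball_adj d r)) X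
    <= 8 * d%:R * d.-1%:R ^+ r.
  by apply: ge_inf => //; exists 0 => C [/ltW].
split; first by rewrite -invfM lef_pV2 ?posrE.
have qr : d.-1%:R ^+ r = d.-1%:R * d.-1%:R ^+ r.-1 :> R by rewrite -exprS prednK.
rewrite ler_pdivlMr ?exprn_gt0 // mulrC ler_pdivrMr //.
by rewrite qr mulrAC mulrC ler_pM2r.
Qed.
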